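(* There exists $n_0$ such that the following holds. If $n \ge n_0$ and $b \ge 2$ are integers, $p \ge 7$ is a prime, $a$ is a positive integer, and $$n! = \frac{b^p-1}{b-1} + a,$$ then $$a \ge \frac{0.5\log\log n}{\log\log\log n}.$$
   Context: $\log$ denotes the natural logarithm. *)

(* Defs.v *)
From HB Require Import structures.
From mathcomp Require Import all_boot all_order all_algebra.
From mathcomp Require Import reals exp.

Set Implicit Arguments.
Unset Strict Implicit.
Unset Printing Implicit Defensive.

(* Main.v *)
Require Import Defs.
From mathcomp Require Import all_boot all_order all_algebra.
From mathcomp Require Import reals exp.
From mathcomp Require Import cyclic sequences zify lra.

Set Implicit Arguments.
Unset Strict Implicit.
Unset Printing Implicit Defensive.

Import Order.TTheory GRing.Theory Num.Theory.
Local Open Scope ring_scope.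

(* Let S = 1 + b + ... + b^(p-1) and suppose 2a <= n. As a divides n!, it
   divides S, so every prime factor of a is p or is 1 modulo p.
   - If p divides a, then b = 1 (mod p), hence S = p (mod p^2); since p^2
     divides n! = S + a, this gives a/p = -1 (mod p), whereas a/p is a product
     of primes that are 1 modulo p.
   - If p does not divide a and p <= n, then a = 1 (mod p), S is 0 or 1 modulo
     p and p divides S + a, which is impossible for p > 2.
   - If p > n, then a = 1 and b < n, so that b divides n! - 1 - a = n! - 2;
     hence b = 2 and n! = 2^p, which is not divisible by 3.
   So a > n/2, far more than what is claimed. *)

Section NatRepunit.
Local Open Scope nat_scope.

Lemma eq_mod1_prime_divisors p a :
  0 < a -> (forall q, prime q -> q %| a -> q = 1 %[mod p]) -> a = 1 %[mod p].
Proof.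
move=> a_gt0 Hq; rewrite (prod_prime_decomp a_gt0) prime_decompE big_map.
rewrite big_seq; apply: (big_ind (fun x => x = 1 %[mod p])) => //.
- by move=> x y Hx Hy; rewrite -modnMm Hx Hy modnMm.
- move=> q; rewrite mem_primes /= => /and3P[q_pr _ qa].
  by rewrite -modnXm (Hq _ q_pr qa) modnXm exp1n.
Qed.

Lemma dvdn_fact_le m n : m <= n -> m`! %| n`!.
Proof. by move=> mn; rewrite (fact_split mn) dvdn_mulr. Qed.

Lemma leq_fact_exp n : n`! <= n ^ n.
Proof.
elim: n => // n IH; rewrite factS expnS leq_mul2l /=.
apply: leq_trans IH _; case: n => // n.
by rewrite leq_exp2r.
Qed.

Lemma subn1_mul_sum_expn b p : (b - 1) * (\sum_(i < p) b ^ i) = b ^ p - 1.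
Proof. by rewrite !subn1 -predn_exp. Qed.

Lemma sum_expn_eq_mod1 b p q :
  b = 1 %[mod q] -> \sum_(i < p) b ^ i = p %[mod q].
Proof.
move=> b1; elim: p => [|p IH]; first by rewrite big_ord0.
by rewrite big_ord_recr /= -modnDm IH -modnXm b1 modnXm modnDm exp1n addn1.
Qed.

(** The order of [b] modulo [q] divides both [p] and [q - 1]. Unless [p] divides [q - 1], these are
    coprime, so [b] is 1 modulo [q], the sum is [p] modulo [q], and [q] divides [p]. *)
Lemma prime_dvd_sum_expn b p q : 0 < b -> prime p -> prime q ->
  q %| \sum_(i < p) b ^ i -> q = p \/ q = 1 %[mod p].
Proof.
move=> b_gt0 p_pr q_pr qS.
have bp1 : b ^ p = 1 %[mod q].
  apply/eqP; rewrite eqn_mod_dvd ?expn_gt0 ?b_gt0 //.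
  by rewrite -subn1_mul_sum_expn dvdn_mull.
have p_gt0 := prime_gt0 p_pr; have q_gt1 := prime_gt1 q_pr.
have [pq1|npq1] := boolP (p %| q - 1).
  by right; apply/eqP; rewrite eqn_mod_dvd // prime_gt0.
left; have cop_bq : coprime b q.
  rewrite coprime_sym prime_coprime //; apply/negP => qb.
  by move: bp1; rewrite -modnXm (eqP qb) exp0n // mod0n modn_small.
have bq1 : b ^ (q - 1) = 1 %[mod q].
  by rewrite subn1 -[q.-1]totient_prime // Euler_exp_totient.
have b1 : b = 1 %[mod q].
  (* Bezout: [u * p = v * (q - 1) + 1]; raising [b] to both sides gives 1 on the left and [b] on the
     right. *)
  case: (egcdnP (q - 1) p_gt0) => u v uv _.
  move: uv; have -> : gcdn p (q - 1) = 1 by apply/eqP; rewrite -/(coprime _ _) prime_coprime.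
  move=> uv.
  have : b ^ (u * p) = 1 %[mod q] by rewrite mulnC expnM -modnXm bp1 modnXm exp1n.
  by rewrite uv expnD expn1 -modnMml [v * _]mulnC expnM -modnXm bq1 modnXm exp1n modnMml mul1n.
have := sum_expn_eq_mod1 p b1; rewrite (eqP qS) => /esym/eqP qp.
by apply/eqP; rewrite -dvdn_prime2.
Qed.

(** Writing [b = 1 + p * y] and expanding to first order, the sum is [p + 'C(p, 2) * (p * y)] modulo
    [p ^ 2], and [p] divides ['C(p, 2)] because it is odd. *)
Lemma sum_expn_eq_mod_sqr b p : prime p -> 2 < p -> b = 1 %[mod p] -> 0 < b ->
  \sum_(i < p) b ^ i = p %[mod p ^ 2].
Proof.
move=> p_pr p_gt2 b1 b_gt0.
have [y ->] : exists y, b = 1 + p * y.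
  move/eqP: b1; rewrite eqn_mod_dvd // => /dvdnP[y yP].
  by exists y; lia.
have expE i : exists z, (1 + p * y) ^ i = 1 + i * (p * y) + p ^ 2 * z.
  elim: i => [|i [z IH]]; first by exists 0; rewrite muln0.
  by exists (z + i * y ^ 2 + p * y * z); rewrite expnS IH; nia.
have sumE m : exists z,
    \sum_(i < m) (1 + p * y) ^ i = m + 'C(m, 2) * (p * y) + p ^ 2 * z.
  elim: m => [|m [z IH]]; first by exists 0; rewrite big_ord0 muln0.
  have [w wE] := expE m.
  by exists (z + w); rewrite big_ord_recr /= IH wE binS bin1; lia.
have [z ->] := sumE p.
have /dvdnP[c ->] : p %| 'C(p, 2) by rewrite prime_dvd_bin.
have -> : p + c * p * (p * y) + p ^ 2 * z = (c * y + z) * p ^ 2 + p by nia.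
by rewrite modnMDl.
Qed.

Lemma fact_eq_repunit_add_gt n b p a :
  3 <= n -> 2 <= b -> prime p -> 2 < p -> 0 < a ->
  n`! = \sum_(i < p) b ^ i + a -> n < a.*2.
Proof.
move=> n_ge3 b_ge2 p_pr p_gt2 a_gt0 E; rewrite ltnNge; apply/negP => le2an.
have p_gt0 := prime_gt0 p_pr; have b_gt0 : 0 < b by lia.
have not_p2 : ~~ (p %| 2) by rewrite gtnNdvd.
have dvd_fact k : 0 < k -> k <= n -> k %| n`! by move=> *; rewrite dvdn_fact // ; lia.
have aS : a %| \sum_(i < p) b ^ i.
  by rewrite -(dvdn_addl _ (dvdnn a)) -E dvd_fact //; lia.
have qa q : prime q -> q %| a -> q = p \/ q = 1 %[mod p].
  by move=> q_pr qa; apply: (prime_dvd_sum_expn b_gt0 p_pr q_pr); apply: dvdn_trans aS.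
have bpb : b ^ p = b %[mod p] by apply: fermat_little.
have dvd_p1 : p %| b ^ p - 1 -> b = 1 %[mod p].
  by rewrite -eqn_mod_dvd ?expn_gt0 ?b_gt0 // bpb => /eqP.
have [pa|npa] := boolP (p %| a).
  have b1 : b = 1 %[mod p].
    apply: dvd_p1; rewrite -subn1_mul_sum_expn dvdn_mull //.
    exact: dvdn_trans aS.
  have p_le_a : p <= a by apply: dvdn_leq.
  (* Since [2p <= 2a <= n], both [p] and [2p] occur as factors in the factorial. *)
  have : p ^ 2 %| n`!.
    have [k pk kn] : exists2 k, p.*2 = k.+1 & k < n.
      by exists p.*2.-1; clear -p_gt0 p_le_a le2an; lia.
    apply: dvdn_trans (dvdn_fact_le kn).
    rewrite factS -pk -mulnn -muln2 dvdn_mul ?dvdn_mulr // dvdn_fact //.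
    by clear -p_gt0 pk; lia.
  rewrite E /dvdn -modnDml sum_expn_eq_mod_sqr // modnDml -/(dvdn _ _).
  case/dvdnP: (pa) => c aE.
  have -> : p + a = p * (1 + c) by rewrite aE mulnDr muln1 [c * p]mulnC.
  rewrite -mulnn dvdn_pmul2l // => pc.
  (* The prime [p] cannot divide [c], since it divides [1 + c]; all prime factors of [c] are thus 1
     modulo [p]. *)
  have c1 : c = 1 %[mod p].
    apply: eq_mod1_prime_divisors => [|q q_pr qc].
      by move: a_gt0; rewrite aE muln_gt0 => /andP[].
    case: (qa q q_pr) => //; first by rewrite aE dvdn_mulr.
    move=> qp; move: qc; rewrite qp => qc; move: pc; rewrite dvdn_addl //.
    by rewrite dvdn1 => /eqP p1; rewrite p1 in p_gt2.
  by move: pc; rewrite /dvdn -modnDmr c1 modnDmr -/(dvdn _ _) (negbTE not_p2).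
have qa1 q : prime q -> q %| a -> q = 1 %[mod p].
  by move=> q_pr q_a; case: (qa q q_pr q_a) => // qp; rewrite -qp q_a in npa.
have a1 := eq_mod1_prime_divisors a_gt0 qa1.
have [p_le_n|n_lt_p] := leqP p n.
  have : p %| \sum_(i < p) b ^ i + a by rewrite -E dvd_fact.
  have [/eqP b1|nb1] := boolP (b == 1 %[mod p]).
    by rewrite dvdn_addr ?(negbTE npa) // /dvdn sum_expn_eq_mod1 // modnn.
  (* By Fermat, [b - 1] may be replaced by [b ^ p - 1], which is [b - 1] times the sum; this turns
     [(b - 1) * (1 + a)] into [b - 1] times the sum plus [a]. *)
  move=> pSa; have : p %| (b - 1) * (1 + a).
    have -> : (b - 1) * (1 + a) = (b - 1) * a + (b - 1).
      by rewrite addnC mulnDr muln1.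
    rewrite /dvdn.
    have bE : b - 1 = b ^ p - 1 %[mod p].
      apply/eqP; rewrite -(eqn_modDr 1) !subnK ?expn_gt0 ?b_gt0 //.
      by rewrite bpb.
    by rewrite -modnDmr bE modnDmr -subn1_mul_sum_expn -mulnDr addnC -/(dvdn _ _) dvdn_mull.
  rewrite Euclid_dvdM // -eqn_mod_dvd // (negbTE nb1) /=.
  by rewrite /dvdn -modnDmr a1 modnDmr -/(dvdn _ _) (negbTE not_p2).
have aE : a = 1.
  have a_lt_p : a < p by clear -le2an n_lt_p; lia.
  by move: a1; rewrite !modn_small // prime_gt1.
rewrite {}aE in E.
(* Otherwise [n! <= n ^ n <= n ^ (p - 1) <= b ^ (p - 1)], yet [b ^ (p - 1)] is only one term of the
   sum. *)
have b_lt_n : b < n.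
  rewrite ltnNge; apply/negP => n_le_b.
  have : b ^ p.-1 < n`!.
    rewrite E -[in X in _ < X](prednK p_gt0) big_ord_recr /= addn1 ltnS.
    exact: leq_addl.
  apply/negP; rewrite -leqNgt; apply: leq_trans (leq_fact_exp n) _.
  apply: (@leq_trans (n ^ p.-1)); last first.
    by rewrite leq_exp2r // -ltnS prednK // (ltn_trans _ p_gt2).
  by rewrite leq_exp2l ?(ltn_trans _ n_ge3) // -ltnS prednK.
(* Modulo [b] only the term [b ^ 0] of the sum survives, and [a = 1] adds another 1. *)
have : b %| 2.
  have : b %| n`! by apply: dvd_fact => //; apply: ltnW.
  rewrite E; case: (p) p_gt0 => // p' _; rewrite big_ord_recl /= expn0.
  rewrite addnAC dvdn_addl //.
  by apply: dvdn_sum => i _; rewrite /bump /= dvdn_exp.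
move/(dvdn_leq (isT : 0 < 2)) => b_le2.
have b2 : b = 2 by apply/eqP; rewrite eqn_leq b_le2.
have nE : n`! = 2 ^ p.
  by rewrite E b2 -[\sum_(i < p) _]mul1n (subn1_mul_sum_expn 2) subnK ?expn_gt0.
have : 3 %| n`! by apply: dvd_fact.
by rewrite nE Euclid_dvdX.
Qed.

End NatRepunit.

Theorem theorem1 (R : realType) :
  exists n0 : nat, forall n b p a : nat,
    (n0 <= n)%N -> (2 <= b)%N -> prime p -> (7 <= p)%N -> (0 < a)%N ->
    n`!%:R = (b%:R ^+ p - 1) / (b%:R - 1) + a%:R :> R ->
    a%:R >= 1 / 2 * ln (ln n%:R) / ln (ln (ln n%:R)) :> R.
Proof.
pose e3 : R := expR (expR (expR 1)).
exists (maxn 3 (Num.bound e3)) => n b p a; rewrite geq_max => /andP[n_ge3 n_large].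
move=> b_ge2 p_pr p_ge7 a_gt0 E.
have n_lt_2a : (n < a.*2)%N.
  apply: (@fact_eq_repunit_add_gt n b p a) => //; first by lia.
  apply/eqP; rewrite -(eqr_nat R) E natrD natr_sum; apply/eqP; congr (_ + _).
  have b1 : b%:R - 1 != 0 :> R by rewrite subr_eq0 pnatr_eq1; lia.
  rewrite subrX1 mulrC mulKf //.
  by apply: eq_bigr => i _; rewrite natrX.
have e3n : e3 <= n%:R.
  apply: ltW; apply: lt_le_trans (_ : (Num.bound e3)%:R <= _); last by rewrite ler_nat.
  by rewrite archi_boundP // expR_ge0.
have n_gt0 : 0 < n%:R :> R by rewrite ltr0n; lia.
have e3_gt0 : 0 < e3 by apply: expR_gt0.
have l1 : expR (expR 1) <= ln n%:R :> R.
  by rewrite -(expRK (expR (expR 1))) ler_ln // posrE.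
have l1_gt0 : 0 < ln n%:R :> R by apply: lt_le_trans l1; apply: expR_gt0.
have l2 : expR 1 <= ln (ln n%:R) :> R.
  by rewrite -(expRK (expR 1)) ler_ln // posrE expR_gt0.
have l2_gt0 : 0 < ln (ln n%:R) :> R by apply: lt_le_trans l2; apply: expR_gt0.
have l3 : 1 <= ln (ln (ln n%:R)) :> R.
  by rewrite -[leLHS]expRK ler_ln // posrE expR_gt0.
have ll_lt_n : ln (ln n%:R) < n%:R :> R.
  by apply: lt_trans (ln_sublinear l1_gt0) (ln_sublinear n_gt0).
have n_le_2a : n%:R <= 2 * a%:R :> R by rewrite -natrM ler_nat; lia.
rewrite ler_pdivrMr; last by apply: lt_le_trans l3.
apply: (@le_trans _ _ (a%:R * 1)); last by rewrite ler_wpM2l.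
by lra.
Qed.
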